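(* Let $m,n,p\in\mathbb{N}$, let $Q$ be the quiver described in the context, $\alpha=(1,n)$, $\theta_+=(-n,1)$ and $\theta_-=(n,-1)$. Then the moduli space of completely controllable systems is isomorphic to the moduli space of $\theta_+$-stable representations of $Q$ of dimension vector $\alpha$, and the moduli space of completely observable systems is isomorphic to the moduli space of $\theta_-$-stable representations of $Q$ of dimension vector $\alpha$: $$\mathrm{sys}^{cc}_{m,n,p}\cong \mathrm{moduli}^{\theta_+}_\alpha Q\qquad\text{and}\qquad \mathrm{sys}^{co}_{m,n,p}\cong \mathrm{moduli}^{\theta_-}_\alpha Q.$$
   Context: $V_{m,n,p}=M_n(\mathbb{C})\times M_{n\times m}(\mathbb{C})\times M_{p\times n}(\mathbb{C})$, with $GL_n=GL_n(\mathbb{C})$ acting by $g.(A,B,C)=(gAg^{-1},gB,Cg^{-1})$. A system $\Sigma=(A,B,C)$ is completely controllable if $c(\Sigma)=[\,B\ AB\ \cdots\ A^{n-1}B\,]$ has rank $n$, and completely observable if the matrix $o(\Sigma)$ obtained by stacking $C,CA,\ldots,CA^{n-1}$ has rank $n$. The corresponding open subsets $V^{cc}_{m,n,p}$, $V^{co}_{m,n,p}$ of $V_{m,n,p}$ have trivial $GL_n$-stabilizers, and $\mathrm{sys}^{cc}_{m,n,p}=V^{cc}_{m,n,p}/GL_n$, $\mathrm{sys}^{co}_{m,n,p}=V^{co}_{m,n,p}/GL_n$ are the orbit spaces. $Q$ is the quiver with two vertices (left and right), $m$ arrows from left to right, $p$ arrows from right to left, and one loop at the right vertex; $\mathrm{rep}_\alpha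 Q$ is the space of complex representations of dimension vector $\alpha=(1,n)$ (dimension $1$ at the left vertex, $n$ at the right vertex), with the basechange action of $GL(\alpha)=\mathbb{C}^*\times GL_n$. For $\theta\in\mathbb{Z}^2$, $V\in\mathrm{rep}_\alpha Q$ is $\theta$-semistable (resp. $\theta$-stable) if every proper non-zero subrepresentation $W$, of dimension vector $\beta$, satisfies $\theta.\beta\ge 0$ (resp. $\theta.\beta>0$). $\mathrm{moduli}^{\theta}_\alpha Q$ is A. King's moduli space of $\theta$-semistable representations (the GIT quotient of the $\theta$-semistable locus of $\mathrm{rep}_\alpha Q$ by $GL(\alpha)$), whose points classify isomorphism classes of direct sums of $\theta$-stable representations. *)

(* Defs.v *)
From mathcomp Require Import all_boot all_order all_algebra.
From mathcomp Require Import boolp classical_sets reals complex.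
From mathcomp Require Import mpoly.

Set Implicit Arguments.
Unset Strict Implicit.
Unset Printing Implicit Defensive.

Import Order.TTheory GRing.Theory Num.Theory.
Local Open Scope ring_scope.

(* Varieties are handled as "spaces with functions": a set of (closed)      *)
(* points, its Zariski-open subsets, and for each open U the functions that *)
(* are regular on U.  A regular function on U is represented by a function  *)
(* on all points, of which only the values on U matter.  Over an            *)
(* algebraically closed field this is the classical notion of variety, and  *)
(* isomorphisms are the bijections preserving both structures.              *)

Record fspace (K : Type) := FSpace {
  point : Type;
  is_open : set point -> Prop;
  regular : set point -> (point -> K) -> Prop
}.

Definition is_fmorphism (K : Type) (X Y : fspace K)
    (phi : point X -> point Y) : Prop :=
  forall U : set (point Y), is_open U ->
    is_open (phi @^-1` U)%classic /\
    (forall h, regular U h -> regular (phi @^-1` U)%classic (h \o phi)).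

Definition fisomorphic (K : Type) (X Y : fspace K) : Prop :=
  exists (phi : point X -> point Y) (psi : point Y -> point X),
    [/\ cancel phi psi, cancel psi phi, is_fmorphism phi & is_fmorphism psi].

Definition polyfun (K : fieldType) (X : Type) (I : finType)
    (coord : I -> X -> K) (f : X -> K) : Prop :=
  exists P : {mpoly K[#|I|]}, forall x, f x = P.@[fun i => coord (enum_val i) x].

(* The locus P of an affine space X: Zariski topology, and functions that   *)
(* are locally fractions of polynomial functions.                           *)
Definition zariski (K : fieldType) (X : Type) (I : finType)
    (coord : I -> X -> K) (P : set X) : fspace K :=
  @FSpace K {x : X | P x}
    (fun U => forall x, U x ->
       exists f, [/\ polyfun coord f, f (sval x) != 0 &
                     forall y, f (sval y) != 0 -> U y])
    (fun U h => forall x, U x ->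
       exists a b, [/\ polyfun coord a, polyfun coord b, b (sval x) != 0 &
         forall y, U y -> b (sval y) != 0 -> h y = a (sval y) / b (sval y)]).

Definition eqclass (T : Type) (e : T -> T -> Prop) (x : T) : set T :=
  [set y | e x y]%classic.

Definition quot (T : Type) (e : T -> T -> Prop) : Type :=
  {S : set T | exists x, S = eqclass e x}.

Definition quot_pi (T : Type) (e : T -> T -> Prop) (x : T) : quot e :=
  exist _ (eqclass e x) (ex_intro _ x erefl).

(* Quotient topology, and functions whose pullback is regular; for an orbit *)
(* relation the latter are the invariant regular functions.                 *)
Definition quot_fspace (K : Type) (X : fspace K)
    (e : point X -> point X -> Prop) : fspace K :=
  @FSpace K (quot e)
    (fun U => is_open (quot_pi e @^-1` U)%classic)
    (fun U h => regular (quot_pi e @^-1` U)%classic (h \o quot_pi e)).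

Definition system (K : fieldType) (m n p : nat) : Type :=
  ('M[K]_n * 'M[K]_(n, m) * 'M[K]_(p, n))%type.

Definition sysA (K : fieldType) (m n p : nat) (S : system K m n p) := S.1.1.
Definition sysB (K : fieldType) (m n p : nat) (S : system K m n p) := S.1.2.
Definition sysC (K : fieldType) (m n p : nat) (S : system K m n p) := S.2.

Definition sys_coord (K : fieldType) (m n p : nat)
    (i : 'I_n * 'I_n + 'I_n * 'I_m + 'I_p * 'I_n) (S : system K m n p) : K :=
  match i with
  | inl (inl (i, j)) => sysA S i j
  | inl (inr (i, j)) => sysB S i j
  | inr (i, j) => sysC S i j
  end.

Definition sys_act (K : fieldType) (m n p : nat) (g : 'M[K]_n)
    (S : system K m n p) : system K m n p :=
  (g *m sysA S *m invmx g, g *m sysB S, sysC S *m invmx g).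

Definition ctrl_mx (K : fieldType) (m n p : nat) (S : system K m n p) :=
  \mxrow_(i < n) (sysA S ^+ i *m sysB S).

Definition obs_mx (K : fieldType) (m n p : nat) (S : system K m n p) :=
  \mxcol_(i < n) (sysC S *m sysA S ^+ i).

Definition completely_controllable (K : fieldType) (m n p : nat)
    (S : system K m n p) : Prop := \rank (ctrl_mx S) = n.

Definition completely_observable (K : fieldType) (m n p : nat)
    (S : system K m n p) : Prop := \rank (obs_mx S) = n.

Definition sys_orbit_space (K : fieldType) (m n p : nat)
    (P : set (system K m n p)) : fspace K :=
  quot_fspace (X := zariski (@sys_coord K m n p) P)
    (fun S T => exists2 g : 'M[K]_n, g \in unitmx & sval T = sys_act g (sval S)).

Definition sys_cc (K : fieldType) (m n p : nat) : fspace K :=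
  sys_orbit_space (@completely_controllable K m n p).

Definition sys_co (K : fieldType) (m n p : nat) : fspace K :=
  sys_orbit_space (@completely_observable K m n p).

Record quiver := Quiver {
  vertex : finType;
  arrow : finType;
  tail : arrow -> vertex;
  head : arrow -> vertex
}.

(* Matrices act on column vectors.                                          *)
Definition rep (K : fieldType) (Q : quiver) (alpha : vertex Q -> nat) : Type :=
  forall a : arrow Q, 'M[K]_(alpha (head a), alpha (tail a)).

Definition rep_coord (K : fieldType) (Q : quiver) (alpha : vertex Q -> nat)
    (i : {a : arrow Q & ('I_(alpha (head a)) * 'I_(alpha (tail a)))%type})
    (V : rep K alpha) : K :=
  V (tag i) (tagged i).1 (tagged i).2.

Definition in_GL (K : fieldType) (Q : quiver) (alpha : vertex Q -> nat)
    (g : forall v, 'M[K]_(alpha v)) : Prop := forall v, g v \in unitmx.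

Definition rep_act (K : fieldType) (Q : quiver) (alpha : vertex Q -> nat)
    (g : forall v, 'M[K]_(alpha v)) (V : rep K alpha) : rep K alpha :=
  fun a => g (head a) *m V a *m invmx (g (tail a)).

Definition is_subrep (K : fieldType) (Q : quiver) (alpha : vertex Q -> nat)
    (V : rep K alpha) (W : forall v, {vspace 'cV[K]_(alpha v)}) : Prop :=
  forall (a : arrow Q) (x : 'cV[K]_(alpha (tail a))),
    x \in W (tail a) -> V a *m x \in W (head a).

Definition proper_nonzero (K : fieldType) (Q : quiver)
    (alpha : vertex Q -> nat)
    (W : forall v, {vspace 'cV[K]_(alpha v)}) : Prop :=
  ~ (forall v, W v = 0%VS) /\ ~ (forall v, W v = fullv).

Definition pairing (Q : quiver) (theta : vertex Q -> int)
    (beta : vertex Q -> nat) : int := \sum_v theta v * (beta v)%:Z.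

Definition semistable (K : fieldType) (Q : quiver) (alpha : vertex Q -> nat)
    (theta : vertex Q -> int) (V : rep K alpha) : Prop :=
  forall W, is_subrep V W -> proper_nonzero W ->
    0 <= pairing theta (fun v => \dim (W v)).

Definition stable (K : fieldType) (Q : quiver) (alpha : vertex Q -> nat)
    (theta : vertex Q -> int) (V : rep K alpha) : Prop :=
  forall W, is_subrep V W -> proper_nonzero W ->
    0 < pairing theta (fun v => \dim (W v)).

Definition character (K : fieldType) (Q : quiver) (alpha : vertex Q -> nat)
    (theta : vertex Q -> int) (g : forall v, 'M[K]_(alpha v)) : K :=
  \prod_v (\det (g v)) ^ theta v.

(* The polynomial semi-invariants of weight k theta, i.e. the degree k part *)
(* of the graded ring whose Proj is King's moduli space.                    *)
Definition semi_invariant (K : fieldType) (Q : quiver)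
    (alpha : vertex Q -> nat) (theta : vertex Q -> int) (k : nat)
    (f : rep K alpha -> K) : Prop :=
  polyfun (@rep_coord K Q alpha) f /\
  forall g V, in_GL g -> f (rep_act g V) = character theta g ^+ k * f V.

(* V and V' have the same image in Proj: the point of Proj under V is the   *)
(* homogeneous ideal of semi-invariants vanishing at V.                     *)
Definition git_equiv (K : fieldType) (Q : quiver) (alpha : vertex Q -> nat)
    (theta : vertex Q -> int) (V V' : rep K alpha) : Prop :=
  forall k f, semi_invariant theta k f -> (f V = 0 <-> f V' = 0).

(* The image in Proj of a locus P of representations.  The basic open sets  *)
(* of Proj are {f != 0}, with f homogeneous of positive degree; its regular *)
(* functions are locally fractions of homogeneous elements of equal degree. *)
Definition git_quotient (K : fieldType) (Q : quiver) (alpha : vertex Q -> nat)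
    (theta : vertex Q -> int) (P : set (rep K alpha)) : fspace K :=
  let pi := @quot_pi {V : rep K alpha | P V}
              (fun V V' => git_equiv theta (sval V) (sval V')) in
  @FSpace K (quot (fun V V' : {V : rep K alpha | P V} =>
                     git_equiv theta (sval V) (sval V')))
    (fun U => forall V, U (pi V) ->
       exists k f, [/\ (0 < k)%N, semi_invariant theta k f, f (sval V) != 0 &
                       forall V', f (sval V') != 0 -> U (pi V')])
    (fun U h => forall V, U (pi V) ->
       exists k a b,
         [/\ semi_invariant theta k a, semi_invariant theta k b,
             b (sval V) != 0 &
             forall V', U (pi V') -> b (sval V') != 0 ->
               h (pi V') = a (sval V') / b (sval V')]).

Definition moduli (K : fieldType) (Q : quiver) (alpha : vertex Q -> nat)
    (theta : vertex Q -> int) : fspace K :=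
  git_quotient theta (@semistable K Q alpha theta).

Definition moduli_stable (K : fieldType) (Q : quiver)
    (alpha : vertex Q -> nat) (theta : vertex Q -> int) : fspace K :=
  git_quotient theta (@stable K Q alpha theta).

(* false is the left vertex, true the right one; the last arrow is the loop. *)

Definition sys_quiver (m p : nat) : quiver :=
  @Quiver bool ('I_m + 'I_p + unit)%type
    (fun a => match a with
              | inl (inl _) => false | inl (inr _) => true | inr _ => true end)
    (fun a => match a with
              | inl (inl _) => true | inl (inr _) => false | inr _ => true end).

Definition sys_dim (m n p : nat) (v : vertex (sys_quiver m p)) : nat :=
  if v then n else 1%N.

Definition theta_plus (m n p : nat) (v : vertex (sys_quiver m p)) : int :=
  if v then 1 else - n%:Z.

Definition theta_minus (m n p : nat) (v : vertex (sys_quiver m p)) : int :=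
  if v then -1 else n%:Z.

(* Main.v *)
Require Import Defs.
From mathcomp Require Import all_boot all_order all_algebra.
From mathcomp Require Import boolp classical_sets reals complex.
From mathcomp Require Import mpoly.

Set Implicit Arguments.
Unset Strict Implicit.
Unset Printing Implicit Defensive.

Import Order.TTheory GRing.Theory Num.Theory.
Local Open Scope ring_scope.

(** Over any field, a representation of dimension vector (1, n) is a system
    (A, B, C).  The scalar at the left vertex acts on systems as a scalar of
    GL_n does, so a base change (l, g) of the representation is the action of
    [l^-1 g] on the system, and the characters theta_+ and theta_- become
    [det] and [det^-1] ([rep_act_sys], [character_framed]).  Both sides of each
    isomorphism are therefore quotients of loci of systems.

    The loci agree by Kalman's criterion.  Any subrepresentation that is the
    whole line at the left vertex contains all columns of the controllability
    matrix at the right one, and theta_+ is negative on it exactly when its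
    right part is proper; dually, a subrepresentation that vanishes at the left
    vertex lies, at the right one, in the kernel of the observability matrix,
    and theta_- is negative on it if it is nonzero.  Cayley-Hamilton shows that
    n powers of A suffice.  Hence semistable, stable and completely controllable
    (resp. observable) coincide ([semistable_cc], [stable_cc], [semistable_co],
    [stable_co]).

    The quotients agree because systems have local normal forms given by
    semi-invariants.  Let S be completely controllable; some n columns of the
    controllability matrix form an invertible matrix M(S), and M is equivariant
    on all systems.  Acting with M^-1 puts every system with [det M <> 0] in a
    normal form that depends only on its orbit and whose entries are quotients
    of semi-invariants by powers of [det M] of equal weight.  Two
    consequences follow.
    - If the same semi-invariants vanish at S and at T, then S and T have equal
      normal forms and lie in one orbit ([git_equiv_orbit]).
    - For every polynomial f on systems, a high power of [det M] times f
      composed with the normal form is a semi-invariant ([homogenize]).  So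
      invariant Zariski-open sets are unions of basic open sets of Proj, and
      invariant functions that are locally fractions of polynomials are locally
      fractions of semi-invariants of equal weight.
    Together they give [orbit_space_git_quotient].  Observable systems are
    treated in the same way, with n rows of the observability matrix and the
    action of M instead of its inverse. *)

(** * Polynomial functions *)

Section PolynomialFunctions.

Variables (K : fieldType) (X : Type) (I : finType) (coord : I -> X -> K).

Lemma polyfun_ext f g : f =1 g -> polyfun coord f -> polyfun coord g.
Proof. by move=> fg [P HP]; exists P => x; rewrite -fg. Qed.

Lemma polyfun_const c : polyfun coord (fun=> c).
Proof. by exists c%:MP => x; rewrite mevalC. Qed.

Lemma polyfun_coord i : polyfun coord (coord i).
Proof. by exists 'X_(enum_rank i) => x; rewrite mevalXU enum_rankK. Qed.

Lemma polyfunD f g :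
  polyfun coord f -> polyfun coord g -> polyfun coord (fun x => f x + g x).
Proof.
by move=> [P HP] [Q HQ]; exists (P + Q) => x; rewrite mevalD HP HQ.
Qed.

Lemma polyfunM f g :
  polyfun coord f -> polyfun coord g -> polyfun coord (fun x => f x * g x).
Proof.
by move=> [P HP] [Q HQ]; exists (P * Q) => x; rewrite mevalM HP HQ.
Qed.

Lemma polyfun_sum (J : Type) (r : seq J) (F : J -> X -> K) :
  (forall j, polyfun coord (F j)) ->
  polyfun coord (fun x => \sum_(j <- r) F j x).
Proof.
move=> HF; elim: r => [|j r IH].
  by apply: polyfun_ext (polyfun_const 0) => x; rewrite big_nil.
by apply: polyfun_ext (polyfunD (HF j) IH) => x; rewrite big_cons.
Qed.

Lemma polyfun_prod (J : Type) (r : seq J) (F : J -> X -> K) :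
  (forall j, polyfun coord (F j)) ->
  polyfun coord (fun x => \prod_(j <- r) F j x).
Proof.
move=> HF; elim: r => [|j r IH].
  by apply: polyfun_ext (polyfun_const 1) => x; rewrite big_nil.
by apply: polyfun_ext (polyfunM (HF j) IH) => x; rewrite big_cons.
Qed.

Lemma polyfunX f k : polyfun coord f -> polyfun coord (fun x => f x ^+ k).
Proof.
move=> Hf; elim: k => [|k IH].
  by apply: polyfun_ext (polyfun_const 1) => x; rewrite expr0.
by apply: polyfun_ext (polyfunM Hf IH) => x; rewrite exprS.
Qed.

(** Polynomial functions are the algebra generated by the coordinates; this
    replaces all later inductions on polynomials. *)
Lemma polyfun_ind (Phi : (X -> K) -> Prop) :
  (forall f g, f =1 g -> Phi f -> Phi g) ->
  (forall c, Phi (fun=> c)) -> (forall i, Phi (coord i)) ->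
  (forall f g, Phi f -> Phi g -> Phi (fun x => f x + g x)) ->
  (forall f g, Phi f -> Phi g -> Phi (fun x => f x * g x)) ->
  forall f, polyfun coord f -> Phi f.
Proof.
move=> Pext Pc Pcoord PD PM f [P HP].
apply: (Pext (fun x => P.@[fun i => coord (enum_val i) x])) => [x //|].
elim/mpolyind: P {HP} => [|c mon P _ _ IH].
  by apply: Pext (Pc 0) => x; rewrite meval0.
have Hmon : Phi (fun x => \prod_i coord (enum_val i) x ^+ mon i).
  elim: (index_enum _) => [|i r IHr].
    by apply: Pext (Pc 1) => x; rewrite big_nil.
  have Hpow : Phi (fun x => coord (enum_val i) x ^+ mon i).
    elim: (mon i) => [|k IHk]; first by apply: Pext (Pc 1) => x; rewrite expr0.
    by apply: Pext (PM _ _ (Pcoord (enum_val i)) IHk) => x; rewrite exprS.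
  by apply: Pext (PM _ _ Hpow IHr) => x; rewrite big_cons.
apply: Pext (PD _ _ (PM _ _ (Pc c) Hmon) IH) => x.
by rewrite mevalD mevalZ mevalX.
Qed.

Definition polymx a b (M : X -> 'M[K]_(a, b)) : Prop :=
  forall i j, polyfun coord (fun x => M x i j).

Lemma polymxM a b c (M : X -> 'M[K]_(a, b)) (N : X -> 'M[K]_(b, c)) :
  polymx M -> polymx N -> polymx (fun x => M x *m N x).
Proof.
move=> HM HN i j.
apply: (@polyfun_ext (fun x => \sum_k M x i k * N x k j)) => [x|].
  by rewrite mxE.
by apply: polyfun_sum => k; apply: polyfunM.
Qed.

Lemma polymxZ a b (c : X -> K) (M : X -> 'M[K]_(a, b)) :
  polyfun coord c -> polymx M -> polymx (fun x => c x *: M x).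
Proof.
move=> Hc HM i j; apply: polyfun_ext (polyfunM Hc (HM i j)) => x.
by rewrite mxE.
Qed.

Lemma polymx_exp a (M : X -> 'M[K]_a) k :
  polymx M -> polymx (fun x => M x ^+ k).
Proof.
move=> HM; elim: k => [|k IH].
  by move=> i j; apply: polyfun_ext (polyfun_const (1%:M i j)) => x.
move=> i j; apply: polyfun_ext (polymxM HM IH i j) => x.
by rewrite exprS.
Qed.

Lemma polymx_rowsub a b c (f : 'I_c -> 'I_a) (M : X -> 'M[K]_(a, b)) :
  polymx M -> polymx (fun x => rowsub f (M x)).
Proof. by move=> HM i j; apply: polyfun_ext (HM (f i) j) => x; rewrite mxE. Qed.

Lemma polymx_colsub a b c (f : 'I_c -> 'I_b) (M : X -> 'M[K]_(a, b)) :
  polymx M -> polymx (fun x => colsub f (M x)).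
Proof. by move=> HM i j; apply: polyfun_ext (HM i (f j)) => x; rewrite mxE. Qed.

Lemma polyfun_det a (M : X -> 'M[K]_a) :
  polymx M -> polyfun coord (fun x => \det (M x)).
Proof.
move=> HM; apply: polyfun_sum => s; apply: polyfunM; first exact: polyfun_const.
by apply: polyfun_prod => i; apply: HM.
Qed.

Lemma polymx_adj a (M : X -> 'M[K]_a) :
  polymx M -> polymx (fun x => \adj (M x)).
Proof.
move=> HM i j.
apply: (@polyfun_ext (fun x => cofactor (M x) j i)) => [x|]; first by rewrite mxE.
apply: polyfunM; first exact: polyfun_const.
apply: polyfun_det => k l.
by apply: polyfun_ext (HM (lift j k) (lift i l)) => x; rewrite !mxE.
Qed.

End PolynomialFunctions.

Lemma polyfun_comp (K : fieldType) (X Y : Type) (I J : finType)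
    (coordX : I -> X -> K) (coordY : J -> Y -> K) (g : Y -> X) f :
  (forall i, polyfun coordY (fun y => coordX i (g y))) ->
  polyfun coordX f -> polyfun coordY (f \o g).
Proof.
move=> Hg.
apply: (polyfun_ind (Phi := fun f => polyfun coordY (f \o g)))
    => {f} //.
- by move=> f f' ff'; apply: polyfun_ext => y /=; rewrite ff'.
- by move=> c; apply: polyfun_const.
- by move=> f f'; apply: polyfunD.
- by move=> f f'; apply: polyfunM.
Qed.

Lemma scalemxE (K : fieldType) a b (c : K) (M : 'M[K]_(a, b)) i j :
  (c *: M) i j = c * M i j.
Proof. by rewrite mxE. Qed.

Lemma invmx_unique (K : fieldType) n (X Y : 'M[K]_n) :
  X *m Y = 1%:M -> X \in unitmx /\ invmx X = Y.
Proof.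
move=> XY; have [uX _] := mulmx1_unit XY; split => //.
by rewrite -[LHS]mulmx1 -XY mulKmx.
Qed.

Lemma invmxMr (K : fieldType) n (X Y : 'M[K]_n) :
  X \in unitmx -> Y \in unitmx -> invmx (X *m Y) = invmx Y *m invmx X.
Proof.
move=> uX uY; apply: (proj2 (invmx_unique _)).
by rewrite mulmxA mulmxK // mulmxV.
Qed.

(** * Systems, semi-invariants and normal forms *)

Section Systems.

Variables (K : fieldType) (m n p : nat).
Local Notation sys := (system K m n p).
Local Notation coord := (@sys_coord K m n p).
Implicit Types (S T : sys) (g h : 'M[K]_n).

Lemma system_eq S T :
  sysA S = sysA T -> sysB S = sysB T -> sysC S = sysC T -> S = T.
Proof.
by case: S T => [[? ?] ?] [[? ?] ?];
  rewrite /sysA /sysB /sysC /= => -> -> ->.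
Qed.

Lemma system_coord_eq S T : (forall i, coord i S = coord i T) -> S = T.
Proof.
move=> H; apply: system_eq; apply/matrixP => i j.
- exact: H (inl (inl (i, j))).
- exact: H (inl (inr (i, j))).
- exact: H (inr (i, j)).
Qed.

Lemma polymx_sysA : polymx coord (@sysA K m n p).
Proof. by move=> i j; apply: (polyfun_coord coord (inl (inl (i, j)))). Qed.

Lemma polymx_sysB : polymx coord (@sysB K m n p).
Proof. by move=> i j; apply: (polyfun_coord coord (inl (inr (i, j)))). Qed.

Lemma polymx_sysC : polymx coord (@sysC K m n p).
Proof. by move=> i j; apply: (polyfun_coord coord (inr (i, j))). Qed.

Lemma sys_act1 S : sys_act 1%:M S = S.
Proof.
by apply: system_eq; rewrite /sysA /sysB /sysC /= ?invmx1 ?mul1mx ?mulmx1.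
Qed.

Lemma sys_actM g h S : g \in unitmx -> h \in unitmx ->
  sys_act g (sys_act h S) = sys_act (g *m h) S.
Proof.
move=> ug uh.
by apply: system_eq; rewrite /sysA /sysB /sysC /= ?invmxMr ?mulmxA.
Qed.

Lemma sys_actK g S : g \in unitmx -> sys_act (invmx g) (sys_act g S) = S.
Proof. by move=> ug; rewrite sys_actM ?unitmx_inv // mulVmx ?sys_act1. Qed.

Definition sys_orbit S T := exists2 g : 'M[K]_n, g \in unitmx & T = sys_act g S.

Lemma sys_orbit_refl S : sys_orbit S S.
Proof. by exists 1%:M; rewrite ?unitmx1 ?sys_act1. Qed.

Lemma sys_orbit_sym S T : sys_orbit S T -> sys_orbit T S.
Proof.
by case=> g ug ->; exists (invmx g); rewrite ?unitmx_inv ?sys_actK.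
Qed.

Lemma sys_orbit_trans S T U : sys_orbit S T -> sys_orbit T U -> sys_orbit S U.
Proof.
move=> [g ug ->] [h uh ->]; exists (h *m g); first by rewrite unitmx_mul uh.
by rewrite sys_actM.
Qed.

Section SemiInvariants.

Variable eps : int.

(** The exponent [eps] is 1 for theta_+ and -1 for theta_-. *)
Definition sys_semi_invariant (k : nat) (f : sys -> K) : Prop :=
  polyfun coord f /\
  forall g S, g \in unitmx -> f (sys_act g S) = (\det g ^ eps) ^+ k * f S.

Lemma sys_semi_invariant_const c : sys_semi_invariant 0 (fun=> c).
Proof. by split=> [|g S _]; [apply: polyfun_const | rewrite expr0 mul1r]. Qed.

Lemma sys_semi_invariantD k f f' :
  sys_semi_invariant k f -> sys_semi_invariant k f' ->
  sys_semi_invariant k (fun S => f S + f' S).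
Proof.
move=> [pf Hf] [pf' Hf']; split; first exact: polyfunD.
by move=> g S ug; rewrite Hf // Hf' // mulrDr.
Qed.

Lemma sys_semi_invariantM k k' f f' :
  sys_semi_invariant k f -> sys_semi_invariant k' f' ->
  sys_semi_invariant (k + k') (fun S => f S * f' S).
Proof.
move=> [pf Hf] [pf' Hf']; split; first exact: polyfunM.
by move=> g S ug; rewrite Hf // Hf' // exprD mulrACA.
Qed.

Lemma sys_semi_invariantX k f j :
  sys_semi_invariant k f -> sys_semi_invariant (j * k) (fun S => f S ^+ j).
Proof.
move=> [pf Hf]; split; first exact: polyfunX.
by move=> g S ug; rewrite Hf // exprMn -exprM mulnC.
Qed.

(** On the locus [d S <> 0] the matrices [d^-1 u] and [d^-1 v] are inverse to each
    other, and [d^-1 u] transforms as [h |-> h g^-1] under the action of g, so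
    that moving S by it gives a system that depends only on the orbit of S.  The equations are required on all systems, including
    those with [d S = 0], since semi-invariants are global; weight 2 leaves room
    for the factors [det M] that make [u] and [v] polynomial. *)
Record chart (d : sys -> K) (u v : sys -> 'M[K]_n) : Prop := Chart {
  chart_d : sys_semi_invariant 2 d;
  chart_polyu : polymx coord u;
  chart_polyv : polymx coord v;
  chart_u : forall g S, g \in unitmx ->
    u (sys_act g S) = (\det g ^ eps) ^+ 2 *: (u S *m invmx g);
  chart_v : forall g S, g \in unitmx ->
    v (sys_act g S) = (\det g ^ eps) ^+ 2 *: (g *m v S);
  chart_uv : forall S, u S *m v S = (d S ^+ 2)%:M
}.

Section Chart.

Variables (d : sys -> K) (u v : sys -> 'M[K]_n).
Hypothesis ch : chart d u v.

Definition normal_form S : sys := sys_act ((d S)^-1 *: u S) S.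

Lemma normal_form_unit S : d S != 0 ->
  (d S)^-1 *: u S \in unitmx /\ invmx ((d S)^-1 *: u S) = (d S)^-1 *: v S.
Proof.
move=> dS; apply: invmx_unique.
rewrite -scalemxAl -scalemxAr (chart_uv ch) scalerA scale_scalar_mx.
by rewrite -invfM -expr2 mulVf // expf_neq0.
Qed.

Lemma normal_form_orbit S : d S != 0 -> sys_orbit S (normal_form S).
Proof. by move=> /normal_form_unit[uS _]; exists ((d S)^-1 *: u S). Qed.

(** The coordinates of [u A v], [d u B] and [d C v] are semi-invariant: the
    factors g and g^-1 cancel and each product has weight 2 + 2. *)
Lemma normal_form_coord i : exists2 a, sys_semi_invariant 4 a &
  forall S, d S != 0 -> a S = d S ^+ 2 * coord i (normal_form S).
Proof.
have [pd Hd] := chart_d ch.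
have det0 g : g \in unitmx -> \det g ^ eps != 0.
  by rewrite unitmxE unitfE => g0; rewrite expfz_neq0.
case: i => [[[i j]|[i j]]|[i j]].
- exists (fun S => (u S *m sysA S *m v S) i j).
    split.
      apply: polymxM (chart_polyv ch) i j.
      exact: polymxM (chart_polyu ch) polymx_sysA.
    move=> g S ug; rewrite (chart_u ch) // (chart_v ch) //.
    rewrite /sysA /= -/(sysA S) -!scalemxAl -scalemxAr scalerA -exprD scalemxE.
    by rewrite !mulmxA !mulmxKV.
  move=> S dS; rewrite /= /normal_form /sysA /= -/(sysA S).
  have [_ ->] := normal_form_unit dS.
  rewrite -!scalemxAl -scalemxAr scalerA scalemxE mulrA -invfM -expr2.
  by rewrite divff ?mul1r // expf_neq0.
- exists (fun S => d S * (u S *m sysB S) i j).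
    split.
      apply: polyfunM => //.
      exact: polymxM (chart_polyu ch) polymx_sysB i j.
    move=> g S ug; rewrite (chart_u ch) // Hd //.
    rewrite /sysB /= -/(sysB S) -!scalemxAl scalemxE.
    by rewrite !mulmxA mulmxKV // mulrACA -exprD.
  move=> S dS; rewrite /= /normal_form /sysB /= -/(sysB S).
  by rewrite -!scalemxAl scalemxE expr2 -mulrA (mulrA _ (d S)^-1) divff ?mul1r.
- exists (fun S => d S * (sysC S *m v S) i j).
    split.
      apply: polyfunM => //.
      exact: polymxM polymx_sysC (chart_polyv ch) i j.
    move=> g S ug; rewrite (chart_v ch) // Hd //.
    rewrite /sysC /= -/(sysC S) -!scalemxAr scalemxE.
    by rewrite !mulmxA mulmxKV // mulrACA -exprD.
  move=> S dS; rewrite /= /normal_form /sysC /= -/(sysC S).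
  have [_ ->] := normal_form_unit dS.
  by rewrite -!scalemxAr scalemxE expr2 -mulrA (mulrA _ (d S)^-1) divff ?mul1r.
Qed.

(** The semi-invariant of weight [2 k] is [d^k f(normal_form)], which is
    polynomial once k is large enough to clear the denominators. *)
Lemma homogenize f : polyfun coord f ->
  exists N, forall k, (N <= k)%N -> exists2 F, sys_semi_invariant (2 * k) F &
    forall S, d S != 0 -> F S = d S ^+ k * f (normal_form S).
Proof.
have dX k : sys_semi_invariant (2 * k) (fun S => d S ^+ k).
  by rewrite mulnC; apply: sys_semi_invariantX (chart_d ch).
apply: (polyfun_ind (Phi := fun f => exists N, forall k, (N <= k)%N ->
    exists2 F, sys_semi_invariant (2 * k) F &
    forall S, d S != 0 -> F S = d S ^+ k * f (normal_form S))) => {f}.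
- move=> f g fg [N HN]; exists N => k /HN[F HF FE]; exists F => // S dS.
  by rewrite -fg FE.
- move=> c; exists 0%N => k _; exists (fun S => d S ^+ k * c) => //.
  rewrite -[(2 * k)%N]addn0.
  exact: sys_semi_invariantM (dX k) (sys_semi_invariant_const c).
- move=> i; have [a Ha aE] := normal_form_coord i.
  exists 2%N => k k2; exists (fun S => d S ^+ (k - 2) * a S).
    have -> : (2 * k = 2 * (k - 2) + 4)%N by rewrite mulnBr subnK // leq_mul2l.
    exact: sys_semi_invariantM.
  by move=> S dS; rewrite aE // mulrA -exprD subnK.
- move=> f g [N HN] [N' HN']; exists (maxn N N') => k.
  rewrite geq_max => /andP[/HN[F HF FE] /HN'[G HG GE]].
  exists (fun S => F S + G S); first exact: sys_semi_invariantD.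
  by move=> S dS; rewrite FE // GE // mulrDr.
- move=> f g [N HN] [N' HN']; exists (N + N')%N => k kN.
  have [F HF FE] := HN N (leqnn N).
  have [|G HG GE] := HN' (k - N)%N.
    by rewrite leq_subRL // (leq_trans _ kN) ?leq_addr.
  have kE : (N + (k - N) = k)%N by rewrite subnKC // (leq_trans _ kN) ?leq_addr.
  exists (fun S => F S * G S).
    by rewrite -kE mulnDr; apply: sys_semi_invariantM.
  by move=> S dS; rewrite FE // GE // mulrACA -exprD kE.
Qed.

End Chart.

End SemiInvariants.

End Systems.

(** * Set-theoretic quotients *)

Section Quotients.

Variables (T : Type) (e : T -> T -> Prop).
Hypotheses (e_refl : forall x, e x x) (e_sym : forall x y, e x y -> e y x)
  (e_trans : forall x y z, e x y -> e y z -> e x z).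

Lemma quot_piP x y : quot_pi e x = quot_pi e y <-> e x y.
Proof.
split=> [xy|exy].
  have : eqclass e x y by rewrite (congr1 sval xy : eqclass e x = _); apply: e_refl.
  by [].
apply: eq_exist; apply/seteqP; split=> z /= H.
  exact: e_trans (e_sym exy) H.
exact: e_trans exy H.
Qed.

Definition quot_repr (q : quot e) : T := sval (cid (svalP q)).

Lemma quot_reprK q : quot_pi e (quot_repr q) = q.
Proof.
rewrite /quot_repr; case: cid => x /= xE.
by case: q xE => S exS /= xE; apply: eq_exist.
Qed.

End Quotients.

(** * Representations of the quiver as systems *)

Section Representations.

Variables (K : fieldType) (m n p : nat).
Local Notation sys := (system K m n p).
Local Notation coord := (@sys_coord K m n p).
Local Notation reps := (rep K (@sys_dim m n p)).
Local Notation rcoord := (@rep_coord K (sys_quiver m p) (@sys_dim m n p)).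

Definition rep_of_sys (S : sys) : reps := fun a =>
  match a return 'M[K]_(@sys_dim m n p (@Defs.head (sys_quiver m p) a),
                         @sys_dim m n p (@Defs.tail (sys_quiver m p) a)) with
  | inl (inl j) => col j (sysB S)
  | inl (inr i) => row i (sysC S)
  | inr _ => sysA S
  end.

Definition sys_of_rep (V : reps) : sys :=
  (V (inr tt) : 'M[K]_n,
   \matrix_(i, j) (V (inl (inl j)) : 'M[K]_(n, 1)) i ord0,
   \matrix_(i, j) (V (inl (inr i)) : 'M[K]_(1, n)) ord0 j).

Lemma rep_of_sysK : cancel rep_of_sys sys_of_rep.
Proof.
move=> S; apply: system_eq => //; apply/matrixP => i j; by rewrite !mxE.
Qed.

Lemma sys_of_repK : cancel sys_of_rep rep_of_sys.
Proof.
move=> V; apply: functional_extensionality_dep => -[[j|i]|[]] //=;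
  apply/matrixP => k l; by rewrite !mxE ?(ord1 k) ?(ord1 l).
Qed.

(** The element of GL_n that acts on systems as g acts on representations. *)
Definition framed_GL (g : forall v, 'M[K]_(@sys_dim m n p v)) : 'M[K]_n :=
  ((g false : 'M_1) ord0 ord0)^-1 *: (g true : 'M_n).

Lemma GL_left_neq0 (g : forall v, 'M[K]_(@sys_dim m n p v)) :
  in_GL g -> (g false : 'M_1) ord0 ord0 != 0.
Proof.
move=> gG; have := gG false; rewrite unitmxE unitfE.
by rewrite [X in \det X](mx11_scalar (g false : 'M_1)) det_scalar1.
Qed.

Lemma framed_GL_unit g : in_GL g -> framed_GL g \in unitmx.
Proof.
move=> gG; have := gG true; rewrite !unitmxE !unitfE detZ => gt.
by rewrite mulf_neq0 // expf_neq0 // invr_eq0 GL_left_neq0.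
Qed.

Lemma rep_act_sys g V : in_GL g ->
  sys_of_rep (rep_act g V) = sys_act (framed_GL g) (sys_of_rep V).
Proof.
move=> gG; have l0 := GL_left_neq0 gG.
have uT : (g true : 'M_n) \in unitmx := gG true.
pose l := (g false : 'M_1) ord0 ord0.
have gl : (g false : 'M_1) = l%:M by apply: mx11_scalar.
have gi : invmx (g false : 'M_1) = (l^-1)%:M by rewrite gl invmx_scalar.
have hi : invmx (framed_GL g) = l *: invmx (g true : 'M_n).
  by rewrite /framed_GL invmxZ ?invrK // unitmxZ ?unitfE ?invr_eq0.
apply: system_eq; rewrite /sysA /sysB /sysC /= ?hi.
- rewrite /rep_act /= /framed_GL -/l -scalemxAr -!scalemxAl scalerA.
  by rewrite mulrV ?scale1r // unitfE.
- apply/matrixP => i j.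
  rewrite mxE /rep_act /= gi /framed_GL -/l mul_mx_scalar -scalemxAl !scalemxE.
  by congr (_ * _); rewrite !mxE; apply: eq_bigr => k _; rewrite mxE.
- apply/matrixP => i j.
  rewrite mxE /rep_act /= gl mul_scalar_mx -scalemxAl -scalemxAr !scalemxE.
  by congr (_ * _); rewrite !mxE; apply: eq_bigr => k _; rewrite mxE.
Qed.

Definition extend_GL (h : 'M[K]_n) (v : vertex (sys_quiver m p)) :
    'M[K]_(@sys_dim m n p v) :=
  match v return 'M[K]_(@sys_dim m n p v) with true => h | false => 1%:M end.

Lemma extend_GL_in h : h \in unitmx -> in_GL (extend_GL h).
Proof. by move=> uh [] //=; apply: unitmx1. Qed.

Lemma framed_extend_GL h : framed_GL (extend_GL h) = h.
Proof. by rewrite /framed_GL /= mxE invr1 scale1r. Qed.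

Lemma rep_of_sys_act h S : h \in unitmx ->
  rep_of_sys (sys_act h S) = rep_act (extend_GL h) (rep_of_sys S).
Proof.
move=> uh; apply: (can_inj sys_of_repK).
by rewrite rep_act_sys ?framed_extend_GL ?rep_of_sysK //; apply: extend_GL_in.
Qed.

Variables (theta : vertex (sys_quiver m p) -> int) (eps : int).
Hypotheses (theta_right : theta true = eps)
  (theta_left : theta false = - (n%:Z * eps)).

Lemma character_framed g : in_GL g ->
  character theta g = \det (framed_GL g) ^ eps.
Proof.
move=> gG; have l0 := GL_left_neq0 gG.
rewrite /character big_bool theta_left theta_right /framed_GL detZ.
have -> : \det (g false) = (g false : 'M_1) ord0 ord0.
  by rewrite [X in \det X](mx11_scalar (g false : 'M_1)) det_scalar1.
by rewrite expfzMl exprnP exprz_exp exprz_inv [LHS]mulrC.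
Qed.

Lemma polyfun_rep_of_sys f : polyfun rcoord f -> polyfun coord (f \o rep_of_sys).
Proof.
apply: polyfun_comp => -[[[j|i]|[]] [k l]]; rewrite /rep_coord /=.
- apply: polyfun_ext (polyfun_coord coord (inl (inr (k, j)))) => S.
  by rewrite mxE.
- apply: polyfun_ext (polyfun_coord coord (inr (i, l))) => S.
  by rewrite mxE.
- exact: (polyfun_coord coord (inl (inl (k, l)))).
Qed.

Lemma polyfun_sys_of_rep f : polyfun coord f -> polyfun rcoord (f \o sys_of_rep).
Proof.
apply: polyfun_comp => -[[[i j]|[i j]]|[i j]].
- exact: (polyfun_coord rcoord (existT _ (inr tt) (i, j))).
- apply: polyfun_ext
    (polyfun_coord rcoord (existT _ (inl (inl j)) (i, ord0))) => V.
  by rewrite /= /sysB mxE.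
- apply: polyfun_ext
    (polyfun_coord rcoord (existT _ (inl (inr i)) (ord0, j))) => V.
  by rewrite /= /sysC mxE.
Qed.

Lemma semi_invariant_rep k f : sys_semi_invariant eps k f ->
  semi_invariant theta k (f \o sys_of_rep).
Proof.
move=> [pf Hf]; split; first exact: polyfun_sys_of_rep.
move=> g V gG /=; rewrite rep_act_sys // Hf ?framed_GL_unit //.
by rewrite character_framed.
Qed.

Lemma semi_invariant_sys k f : semi_invariant theta k f ->
  sys_semi_invariant eps k (f \o rep_of_sys).
Proof.
move=> [pf Hf]; split; first exact: polyfun_rep_of_sys.
move=> h S uh /=; have hG := extend_GL_in uh.
by rewrite rep_of_sys_act // Hf // character_framed // framed_extend_GL.
Qed.

(** * From normal forms to an isomorphism of quotients *)

Variables (P : set sys) (Q : set reps).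
Hypothesis PQ : forall S, P S <-> Q (rep_of_sys S).
Hypothesis P_act : forall g S, g \in unitmx -> P S -> P (sys_act g S).
Hypothesis P_chart : forall S, P S -> exists d u v, chart eps d u v /\ d S != 0.

(** If c is a coordinate of the normal form of S, then [a - c d^2] is a
    semi-invariant that vanishes at S, hence at T; so c is also the coordinate
    of the normal form of T. *)
Lemma git_equiv_orbit S T : P S -> P T ->
  git_equiv theta (rep_of_sys S) (rep_of_sys T) <-> sys_orbit S T.
Proof.
move=> PS PT; split=> [ST|[g ug ->] k f /semi_invariant_sys[_ Hf]]; last first.
  have /= -> := Hf g S ug.
  have c0 : (\det g ^ eps) ^+ k != 0.
    by rewrite expf_neq0 // expfz_neq0 // -unitfE -unitmxE.
  split=> [->|/eqP]; first by rewrite mulr0.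
  by rewrite mulf_eq0 (negbTE c0) => /eqP.
have ST' k f : sys_semi_invariant eps k f -> f S = 0 -> f T = 0.
  by move=> /semi_invariant_rep /ST /=; rewrite !rep_of_sysK => -[].
have TS' k f : sys_semi_invariant eps k f -> f T = 0 -> f S = 0.
  by move=> /semi_invariant_rep /ST /=; rewrite !rep_of_sysK => -[].
have [d [u [v [ch dS]]]] := P_chart PS.
have dT : d T != 0.
  by apply: contra_neq dS => /(TS' _ _ (chart_d ch)).
suff nST : normal_form d u S = normal_form d u T.
  apply: sys_orbit_trans (normal_form_orbit ch dS) _.
  by rewrite nST; apply/sys_orbit_sym/(normal_form_orbit ch).
apply: system_coord_eq => i; have [a Ha aE] := normal_form_coord ch i.
pose c := coord i (normal_form d u S).
have d2 : sys_semi_invariant eps 4 (fun S => d S ^+ 2).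
  exact: sys_semi_invariantX 2 (chart_d ch).
have Hac : sys_semi_invariant eps 4 (fun S => a S + - c * d S ^+ 2).
  apply: sys_semi_invariantD => //.
  exact: sys_semi_invariantM (sys_semi_invariant_const _ _ _ _ (- c)) d2.
have /eqP : a T + - c * d T ^+ 2 = 0.
  by apply: ST' Hac _; rewrite aE // mulNr [X in X - _]mulrC subrr.
rewrite aE // mulNr [X in X - _]mulrC -mulrBl.
by rewrite mulf_eq0 expf_eq0 (negbTE dT) orbF subr_eq0 => /eqP ->.
Qed.

Local Notation X := (zariski coord P).
Local Notation eX := (fun S T : Defs.point X =>
  exists2 g : 'M[K]_n, g \in unitmx & sval T = sys_act g (sval S)).
Local Notation Y := {V : reps | Q V}.
Local Notation eY := (fun V V' : Y => git_equiv theta (sval V) (sval V')).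

Lemma Q_sys_of_rep V : Q V -> P (sys_of_rep V).
Proof. by move=> QV; apply/PQ; rewrite sys_of_repK. Qed.

Let F (S : Defs.point X) : Y := exist Q _ ((PQ _).1 (svalP S)).
Let G (V : Y) : Defs.point X := exist P _ (Q_sys_of_rep (svalP V)).

Let FK : cancel F G.
Proof. by case=> S PS; apply: eq_exist; apply: rep_of_sysK. Qed.

Let GK : cancel G F.
Proof. by case=> V QV; apply: eq_exist; apply: sys_of_repK. Qed.

Let piX (S T : Defs.point X) : quot_pi eX S = quot_pi eX T <-> eX S T.
Proof.
apply: quot_piP => [x|x y|x y z]; first exact: sys_orbit_refl.
  exact: sys_orbit_sym.
exact: sys_orbit_trans.
Qed.

Let piY (V V' : Y) : quot_pi eY V = quot_pi eY V' <-> eY V V'.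
Proof.
apply: quot_piP => [x k f|x y xy k f /xy[]|x y z xy yz k f Hf] //.
by rewrite (xy _ _ Hf) (yz _ _ Hf).
Qed.

Let eF (S T : Defs.point X) : eX S T <-> eY (F S) (F T).
Proof. by case: S T => S PS [T PT]; split=> /(git_equiv_orbit PS PT). Qed.

Let phi (q : quot eX) : quot eY := quot_pi eY (F (quot_repr q)).
Let psi (q : quot eY) : quot eX := quot_pi eX (G (quot_repr q)).

Let phi_pi S : phi (quot_pi eX S) = quot_pi eY (F S).
Proof. by apply/piY/eF/piX; rewrite quot_reprK. Qed.

Let psi_pi V : psi (quot_pi eY V) = quot_pi eX (G V).
Proof. by apply/piX/eF; rewrite !GK; apply/piY; rewrite quot_reprK. Qed.

Let phiK : cancel phi psi.
Proof. by move=> q; rewrite -(quot_reprK q) phi_pi psi_pi FK. Qed.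

Let psiK : cancel psi phi.
Proof. by move=> q; rewrite -(quot_reprK q) psi_pi phi_pi GK. Qed.

(** Passing to the normal form stays in the locus and does not change the point
    of the orbit space; polynomial data given near an orbit can therefore be
    evaluated at normal forms only. *)
Lemma chart_normalize (S0 : sys) : P S0 -> exists d u v,
  [/\ chart eps d u v, d S0 != 0 &
    forall S : Defs.point X, d (sval S) != 0 -> exists2 T : Defs.point X,
      sval T = normal_form d u (sval S) & quot_pi eX T = quot_pi eX S].
Proof.
move=> /P_chart[d [u [v [ch d0]]]]; exists d, u, v; split=> // -[S PS] /= dS.
have [g ug nE] := normal_form_orbit ch dS.
have PT : P (normal_form d u S) by rewrite nE; apply: P_act.
exists (exist _ _ PT) => //.
by apply/esym/piX => /=; exists g.
Qed.

Let phi_morphism :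
  @is_fmorphism K (quot_fspace (X := X) eX) (git_quotient theta Q) phi.
Proof.
move=> U oU; split=> [S US|h rh S US].
  have [k [f [_ /semi_invariant_sys[pf _] fS fU]]] : exists k f, _ :=
    oU (F S) (eq_ind _ U US _ (phi_pi S)).
  exists (f \o rep_of_sys); split=> // T fT.
  by rewrite /preimage /= phi_pi; apply: fU.
have [k [a [b [/semi_invariant_sys[pa _] /semi_invariant_sys[pb _] bS bU]]]] :=
  rh (F S) (eq_ind _ U US _ (phi_pi S)).
exists (a \o rep_of_sys), (b \o rep_of_sys); split=> // T UT bT.
by rewrite /= phi_pi; apply: (bU (F T)) => //; rewrite -phi_pi.
Qed.

(** Data near a point of the orbit space are taken at its normal form and
    homogenized.  The extra factor [d] confines the nonvanishing locus to the
    domain of the chart and makes the weight positive. *)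
Let psi_morphism :
  @is_fmorphism K (git_quotient theta Q) (quot_fspace (X := X) eX) psi.
Proof.
move=> U oU; split=> [|h rh] /= V UV.
  have {}UV : U (quot_pi eX (G V)) by rewrite -psi_pi.
  have [d [u [v [ch dS HS]]]] := chart_normalize (svalP (G V)).
  have [T TE piT] := HS _ dS.
  have [f [pf fT fU]] : exists f, _ := oU T (eq_ind_r U UV piT).
  have [N HN] := homogenize ch pf; have [H Hinv HE] := HN N (leqnn N).
  exists (2 + 2 * N)%N, ((fun S => d S * H S) \o sys_of_rep); split=> //.
  - exact/semi_invariant_rep/(sys_semi_invariantM (chart_d ch) Hinv).
  - rewrite /= mulf_neq0 // HE // mulf_neq0 ?expf_neq0 //.
    by rewrite -TE.
  move=> V' /=; rewrite mulf_eq0 => /norP[dV' HV'].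
  rewrite /preimage /= psi_pi.
  have [T' TE' piT'] := HS (G V') dV'; rewrite -piT'.
  apply: fU; rewrite TE'.
  by move: HV'; rewrite HE // mulf_eq0 => /norP[].
have {}UV : U (quot_pi eX (G V)) by rewrite -psi_pi.
have [d [u [v [ch dS HS]]]] := chart_normalize (svalP (G V)).
have [T TE piT] := HS _ dS.
have [a [b [pa pb bT bU]]] := rh T (eq_ind_r U UV piT).
have [Na HNa] := homogenize ch pa; have [Nb HNb] := homogenize ch pb.
pose N := maxn Na Nb.
have [A Ainv AE] := HNa N (leq_maxl _ _).
have [B Binv BE] := HNb N (leq_maxr _ _).
exists (2 + 2 * N)%N, ((fun S => d S * A S) \o sys_of_rep),
  ((fun S => d S * B S) \o sys_of_rep); split.
- exact/semi_invariant_rep/(sys_semi_invariantM (chart_d ch) Ainv).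
- exact/semi_invariant_rep/(sys_semi_invariantM (chart_d ch) Binv).
- rewrite /= mulf_neq0 // BE // mulf_neq0 ?expf_neq0 //.
  by rewrite -TE.
move=> V' /=; rewrite mulf_eq0 psi_pi => UV' /norP[dV' BV'].
have [T' TE' piT'] := HS (G V') dV'; rewrite -piT'.
move: BV'; rewrite AE // BE // mulf_eq0 => /norP[dN bV'].
have -> : h (quot_pi eX T') = a (sval T') / b (sval T').
  by apply: (bU T'); rewrite ?TE' //; rewrite /preimage /= piT'.
by rewrite TE' !mulrA -[RHS]mulf_div divff ?mul1r // mulf_neq0 ?expf_neq0.
Qed.

(** Any locus of systems covered by charts has the same orbit space and GIT
    quotient. *)
Theorem orbit_space_git_quotient :
  fisomorphic (sys_orbit_space P) (git_quotient theta Q).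
Proof. by exists phi, psi; split. Qed.

End Representations.

(** * Charts from equivariant square matrices *)

Section Charts.

Variables (K : fieldType) (m n p : nat).
Local Notation sys := (system K m n p).
Local Notation coord := (@sys_coord K m n p).

(** When M is singular, [invmx M] is M and both sides vanish, whereas
    [det M *: invmx M] would differ from the adjugate of M.  The second factor
    [det M] thus makes the scaled inverse polynomial, and keeps its equivariance
    valid on all systems. *)
Lemma scaled_invmx (M : 'M[K]_n) :
  \det M ^+ 2 *: invmx M = \det M *: \adj M.
Proof.
case uM: (M \in unitmx).
  rewrite /invmx uM scalerA expr2 mulfK //.
  by move: uM; rewrite unitmxE unitfE.
by move: uM; rewrite unitmxE unitfE => /negbFE/eqP ->; rewrite expr2 mul0r !scale0r.
Qed.

Lemma scaled_invmxM (M N : 'M[K]_n) :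
  \det (M *m N) ^+ 2 *: invmx (M *m N)
  = \det (M *m N) ^+ 2 *: (invmx N *m invmx M).
Proof.
case uMN: (M *m N \in unitmx).
  by move: uMN; rewrite unitmx_mul => /andP[uM uN]; rewrite invmxMr.
by move: uMN; rewrite unitmxE unitfE => /negbFE/eqP ->; rewrite expr2 mul0r !scale0r.
Qed.

Lemma det_scaled_invmx (M : 'M[K]_n) :
  (\det M ^+ 2 *: invmx M) *m (\det M ^+ 2 *: M) = ((\det M ^+ 2) ^+ 2)%:M.
Proof.
rewrite scaled_invmx -scalemxAr -scalemxAl mul_adj_mx !scale_scalar_mx.
by rewrite -expr2.
Qed.

Lemma det_invmx_scaled (M : 'M[K]_n) :
  (\det M ^+ 2 *: M) *m (\det M ^+ 2 *: invmx M) = ((\det M ^+ 2) ^+ 2)%:M.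
Proof.
rewrite scaled_invmx -scalemxAr -scalemxAl mul_mx_adj !scale_scalar_mx.
by rewrite mulrCA -expr2.
Qed.

Lemma chart_of_columns (M : sys -> 'M[K]_n) : polymx coord M ->
  (forall g S, g \in unitmx -> M (sys_act g S) = g *m M S) ->
  chart 1 (fun S => \det (M S) ^+ 2) (fun S => \det (M S) ^+ 2 *: invmx (M S))
    (fun S => \det (M S) ^+ 2 *: M S).
Proof.
move=> pM HM; have pd := polyfunX 2 (polyfun_det pM).
split=> [| | |g S ug|g S ug|S]; rewrite ?expr1z.
- by split=> // g S ug; rewrite HM // det_mulmx exprMn expr1z.
- move=> i j; apply: polyfun_ext (polymxZ (polyfun_det pM) (polymx_adj pM) i j).
  by move=> S; rewrite scaled_invmx.
- exact: polymxZ.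
- by rewrite HM // scaled_invmxM det_mulmx exprMn -scalemxAl scalerA.
- by rewrite HM // det_mulmx exprMn -scalemxAr scalerA.
- exact: det_scaled_invmx.
Qed.

Lemma chart_of_rows (M : sys -> 'M[K]_n) : polymx coord M ->
  (forall g S, g \in unitmx -> M (sys_act g S) = M S *m invmx g) ->
  chart (-1) (fun S => \det (M S) ^+ 2) (fun S => \det (M S) ^+ 2 *: M S)
    (fun S => \det (M S) ^+ 2 *: invmx (M S)).
Proof.
move=> pM HM; have pd := polyfunX 2 (polyfun_det pM).
have dE g S : g \in unitmx ->
    \det (M (sys_act g S)) ^+ 2 = (\det g ^ (-1)) ^+ 2 * \det (M S) ^+ 2.
  by move=> ug; rewrite HM // det_mulmx det_inv exprMn mulrC.
split=> [| | |g S ug|g S ug|S].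
- by split.
- exact: polymxZ.
- move=> i j; apply: polyfun_ext (polymxZ (polyfun_det pM) (polymx_adj pM) i j).
  by move=> S; rewrite scaled_invmx.
- by rewrite dE // HM // -scalemxAl scalerA.
- rewrite HM // scaled_invmxM invmxK -HM // dE //.
  by rewrite -scalemxAr scalerA.
- exact: det_invmx_scaled.
Qed.

End Charts.

(** * Charts on controllable and observable systems *)

Lemma expmx0 (K : fieldType) n (A : 'M[K]_n) : A ^+ 0 = 1%:M.
Proof. by []. Qed.

Lemma expmxS (K : fieldType) n (A : 'M[K]_n) k : A ^+ k.+1 = A *m A ^+ k.
Proof. exact: exprS. Qed.

Lemma expmxSr (K : fieldType) n (A : 'M[K]_n) k : A ^+ k.+1 = A ^+ k *m A.
Proof. exact: exprSr. Qed.

Section Kalman.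

Variables (K : fieldType) (m n p : nat).
Local Notation sys := (system K m n p).
Local Notation coord := (@sys_coord K m n p).
Implicit Type S : sys.

Lemma ctrl_mx_act g S : g \in unitmx ->
  ctrl_mx (sys_act g S) = g *m ctrl_mx S.
Proof.
move=> ug; rewrite /ctrl_mx mul_mxrow; apply: eq_mxrow => i.
elim: (val i) => [|k IH]; first by rewrite !expmx0 !mul1mx.
rewrite !expmxS -mulmxA IH /sysA /= -/(sysA S) !mulmxA.
by rewrite mulmxKV.
Qed.

Lemma obs_mx_act g S : g \in unitmx ->
  obs_mx (sys_act g S) = obs_mx S *m invmx g.
Proof.
move=> ug; rewrite /obs_mx mxcol_mul; apply: eq_mxcol => i.
elim: (val i) => [|k IH]; first by rewrite !expmx0 !mulmx1.
rewrite !expmxSr mulmxA IH /sysA /= -/(sysA S) !mulmxA.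
by rewrite mulmxKV.
Qed.

Lemma polymx_ctrl : polymx coord (@ctrl_mx K m n p).
Proof.
move=> i j; rewrite /ctrl_mx.
pose k := tagnat.sig1 j; pose l := tagnat.sig2 j.
have H := polymxM (polymx_exp k (@polymx_sysA K m n p))
  (@polymx_sysB K m n p) i l.
by apply: polyfun_ext H => S; rewrite [RHS]mxE.
Qed.

Lemma polymx_obs : polymx coord (@obs_mx K m n p).
Proof.
move=> i j; rewrite /obs_mx.
pose k := tagnat.sig1 i; pose l := tagnat.sig2 i.
have H := polymxM (@polymx_sysC K m n p)
  (polymx_exp k (@polymx_sysA K m n p)) l j.
by apply: polyfun_ext H => S; rewrite [RHS]mxE.
Qed.

Lemma cc_chart S : completely_controllable S ->
  exists d u v, chart 1 d u v /\ d S != 0.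
Proof.
move=> ccS; have full : row_full (ctrl_mx S)^T.
  by rewrite /row_full mxrank_tr ccS.
pose M (T : sys) := colsub (fullrankfun full) (ctrl_mx T).
have MS : \det (M S) != 0.
  by rewrite -det_tr trmx_mxsub -unitfE -unitmxE fullrowsub_unit.
exists (fun T => \det (M T) ^+ 2), (fun T => \det (M T) ^+ 2 *: invmx (M T)),
  (fun T => \det (M T) ^+ 2 *: M T); split; last by rewrite expf_neq0.
apply: chart_of_columns; first exact: polymx_colsub polymx_ctrl.
by move=> g T ug; rewrite /M ctrl_mx_act // mulmx_colsub.
Qed.

Lemma co_chart S : completely_observable S ->
  exists d u v, chart (-1) d u v /\ d S != 0.
Proof.
move=> coS; have full : row_full (obs_mx S) by rewrite /row_full coS.
pose M (T : sys) := rowsub (fullrankfun full) (obs_mx T).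
have MS : \det (M S) != 0 by rewrite -unitfE -unitmxE fullrowsub_unit.
exists (fun T => \det (M T) ^+ 2), (fun T => \det (M T) ^+ 2 *: M T),
  (fun T => \det (M T) ^+ 2 *: invmx (M T)); split; last by rewrite expf_neq0.
apply: chart_of_rows; first exact: polymx_rowsub polymx_obs.
by move=> g T ug; rewrite /M obs_mx_act // mul_rowsub_mx.
Qed.

Lemma cc_act g S : g \in unitmx -> completely_controllable S ->
  completely_controllable (sys_act g S).
Proof.
move=> ug; rewrite /completely_controllable ctrl_mx_act // eqmxMfull //.
by rewrite row_full_unit.
Qed.

Lemma co_act g S : g \in unitmx -> completely_observable S ->
  completely_observable (sys_act g S).
Proof.
move=> ug; rewrite /completely_observable obs_mx_act // mxrankMfree //.
by rewrite row_free_unit unitmx_inv.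
Qed.

End Kalman.

(** * Stability and Kalman's criterion *)

(** By Cayley-Hamilton, A is a root of its characteristic polynomial, so ['X^k] may
    be replaced by its remainder, of degree less than n. *)
Lemma exp_mx_reduce (K : fieldType) n (A : 'M[K]_n) k :
  exists c : nat -> K, A ^+ k = \sum_(i < n) c i *: A ^+ i.
Proof.
case: n A => [|n] A; first by exists (fun=> 0); apply/matrixP => -[].
pose r := 'X^k %% char_poly A; exists (fun i => r`_i).
have Ak : A ^+ k = horner_mx A r.
  rewrite -[A in LHS]horner_mx_X -rmorphXn /=.
  rewrite [X in horner_mx A X = _](divp_eq _ (char_poly A)).
  by rewrite rmorphD rmorphM /= Cayley_Hamilton mulr0 add0r.
have rn : (size r <= n.+1)%N.
  rewrite -ltnS -(size_char_poly A) ltn_modp.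
  by rewrite monic_neq0 // char_poly_monic.
have rE : r = \sum_(i < n.+1) r`_i *: 'X^i.
  rewrite -(poly_def _ (fun i => r`_i)); apply/polyP => i; rewrite coef_poly.
  by case: ltnP => // ni; rewrite nth_default // (leq_trans rn).
rewrite Ak rE linear_sum /=; apply: eq_bigr => i _.
by rewrite linearZ /= rmorphXn /= horner_mx_X -rE.
Qed.

Lemma mul_exp_mx_eq0 (K : fieldType) a b n (A : 'M[K]_n) (L : 'M_(a, n))
    (N : 'M_(n, b)) :
  (forall i, (i < n)%N -> L *m A ^+ i *m N = 0) ->
  forall k, L *m A ^+ k *m N = 0.
Proof.
move=> H k; have [c ->] := exp_mx_reduce A k.
rewrite mulmx_sumr mulmx_suml big1 // => i _.
by rewrite -scalemxAr -scalemxAl H ?scaler0.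
Qed.

Section Stability.

Variables (K : fieldType) (m n p : nat).
Local Notation sys := (system K m n p).
Implicit Type S : sys.
Local Notation reps := (rep K (@sys_dim m n p)).

Lemma mul_ctrl_mx_eq0 a S (L : 'M_(a, n)) :
  L *m ctrl_mx S = 0 -> forall k, L *m sysA S ^+ k *m sysB S = 0.
Proof.
move=> LS; apply: mul_exp_mx_eq0 => i ni.
have /mxrowP/(_ (Ordinal ni)) : L *m ctrl_mx S = \mxrow_(i < n) (0 : 'M_(a, m)).
  by rewrite LS mxrow0.
by rewrite /ctrl_mx mul_mxrow !mxrowK -mulmxA.
Qed.

Lemma mul_ctrl_mx0 a S (L : 'M_(a, n)) :
  (forall k, L *m sysA S ^+ k *m sysB S = 0) -> L *m ctrl_mx S = 0.
Proof.
move=> H; rewrite /ctrl_mx mul_mxrow -[RHS]mxrow0; apply: eq_mxrow => i.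
by rewrite mulmxA.
Qed.

Lemma obs_mx_mul_eq0 a S (N : 'M_(n, a)) :
  obs_mx S *m N = 0 -> forall k, sysC S *m sysA S ^+ k *m N = 0.
Proof.
move=> SN; apply: mul_exp_mx_eq0 => i ni.
have /mxcolP/(_ (Ordinal ni)) : obs_mx S *m N = \mxcol_(i < n) (0 : 'M_(p, a)).
  by rewrite SN mxcol0.
by rewrite /obs_mx mxcol_mul !mxcolK.
Qed.

Lemma obs_mx_mul0 a S (N : 'M_(n, a)) :
  (forall k, sysC S *m sysA S ^+ k *m N = 0) -> obs_mx S *m N = 0.
Proof.
by move=> H; rewrite /obs_mx mxcol_mul -[RHS]mxcol0; apply: eq_mxcol => i.
Qed.

Definition ker_space a (L : 'M[K]_(a, n)) : {vspace 'cV[K]_n} :=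
  lker (linfun (mulmx L : 'cV_n -> 'cV_a)).

Lemma mem_ker_space a (L : 'M[K]_(a, n)) x : (x \in ker_space L) = (L *m x == 0).
Proof. by rewrite memv_ker lfunE. Qed.

Lemma ker_space_full a (L : 'M[K]_(a, n)) : ker_space L = fullv -> L = 0.
Proof.
move=> LE; apply/matrixP => i j.
have : delta_mx j 0 \in ker_space L by rewrite LE memvf.
by rewrite mem_ker_space -colE => /eqP/matrixP/(_ i 0); rewrite !mxE.
Qed.

Lemma dim_cV a : dim 'cV[K]_a = a.
Proof. by rewrite dim_matrix -[RHS]muln1. Qed.

Lemma left_space_cases (U : {vspace 'cV[K]_1}) : U = 0%VS \/ U = fullv.
Proof.
have [->|U0] := eqVneq U 0%VS; [by left|right].
apply/eqP; rewrite eqEdim subvf dimvf dim_cV.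
by rewrite lt0n dimv_eq0.
Qed.

Lemma pairing_sys theta (W : forall v, {vspace 'cV[K]_(@sys_dim m n p v)}) :
  pairing theta (fun v => \dim (W v)) =
  theta true * (\dim (W true))%:Z + theta false * (\dim (W false))%:Z.
Proof. by rewrite /pairing big_bool. Qed.

Definition sub_dim_spaces (U0 : {vspace 'cV[K]_1}) (U1 : {vspace 'cV[K]_n})
    (v : vertex (sys_quiver m p)) : {vspace 'cV[K]_(@sys_dim m n p v)} :=
  match v return {vspace 'cV[K]_(@sys_dim m n p v)} with
  | true => U1 | false => U0 end.

(** The column space of the controllability matrix, described as the kernel of L,
    where the rows of L span the left kernel of that matrix, is A-invariant and
    contains the columns of B.  With the whole line on the left it is a
    subrepresentation of weight [dim - n]; semistability forces it to be
    everything. *)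
Lemma semistable_cc S :
  semistable (@theta_plus m n p) (rep_of_sys S) -> completely_controllable S.
Proof.
move=> ss; pose L := kermx (ctrl_mx S).
have LAB : forall k, L *m sysA S ^+ k *m sysB S = 0.
  exact/mul_ctrl_mx_eq0/mulmx_ker.
pose W := sub_dim_spaces fullv (ker_space L).
have subW : is_subrep (rep_of_sys S) W.
  move=> [[j|i]|[]] x /=; rewrite ?memvf // ?mem_ker_space.
    move=> _; rewrite mulmxA colE mulmxA.
    by have := LAB 0%N; rewrite expmx0 mulmx1 => ->; rewrite !mul0mx.
  have /submxP[Z LA] : (L *m sysA S <= L)%MS.
    apply/sub_kermxP/mul_ctrl_mx0 => k.
    by have := LAB k.+1; rewrite expmxS mulmxA.
  by move=> /eqP Lx; rewrite mulmxA LA -mulmxA Lx mulmx0.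
have [WT|WT] := eqVneq (ker_space L) fullv.
  move/ker_space_full/eqP: WT; by rewrite kermx_eq0 => /eqP.
have := ss W subW; rewrite pairing_sys /= /theta_plus.
have prW : proper_nonzero W.
  split=> [/(_ false) /= H|/(_ true) /= H]; last by rewrite H eqxx in WT.
  have := dimvf ('cV[K]_1 : vectType K); rewrite H dimv0 dim_cV.
  by [].
move=> /(_ prW); rewrite dimvf dim_cV mul1r mulr1 subr_ge0 lez_nat => nW.
case/eqP: WT; apply/eqP; rewrite eqEdim subvf dimvf dim_cV.
exact: nW.
Qed.

(** A subrepresentation that is everything on the left contains the columns of
    all [A^k B], hence everything on the right; one that is zero on the left has
    the dimension of its right part as weight. *)
Lemma stable_cc S : completely_controllable S ->
  stable (@theta_plus m n p) (rep_of_sys S).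
Proof.
move=> ccS W subW [nzW npW]; rewrite pairing_sys /theta_plus mul1r.
have [W0|W1] := left_space_cases (W false).
  rewrite W0 dimv0 mulr0 addr0 ltz_nat lt0n dimv_eq0; apply/eqP => WT.
  by apply: nzW => -[].
have free : row_free (ctrl_mx S) by apply/eqP.
have WA (x : 'cV[K]_n) : x \in W true -> sysA S *m x \in W true.
  exact: (subW (inr tt)).
have WB (z : 'cV[K]_m) : sysB S *m z \in W true.
  rewrite [z]matrix_sum_delta mulmx_sumr; apply: memv_suml => j _.
  rewrite big_ord1 -scalemxAr memvZ // -colE.
  have := subW (inl (inl j)) 1%:M; rewrite W1 memvf => /(_ isT).
  by rewrite /= mulmx1.
have WAB (z : 'cV[K]_m) k : sysA S ^+ k *m (sysB S *m z) \in W true.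
  elim: k => [|k IH]; first by rewrite expmx0 mul1mx.
  by rewrite expmxS -mulmxA WA.
case: npW => -[] //; apply/vspaceP => x; rewrite memvf.
rewrite -[x]mul1mx -(mulmxVp free) -mulmxA.
rewrite -(submxcolK (pinvmx _ *m x)) /ctrl_mx mul_mxrow_mxcol.
by apply: memv_suml => i _; rewrite -mulmxA; apply: WAB.
Qed.

(** The kernel of the observability matrix, with zero on the left, is a
    subrepresentation whose weight is the opposite of its dimension. *)
Lemma semistable_co S :
  semistable (@theta_minus m n p) (rep_of_sys S) -> completely_observable S.
Proof.
move=> ss; pose W := sub_dim_spaces 0%VS (ker_space (obs_mx S)).
have subW : is_subrep (rep_of_sys S) W.
  move=> [[j|i]|[]] x /=; rewrite ?memv0 ?mem_ker_space.
  - by move=> /eqP ->; rewrite !mulmx0.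
  - move=> /eqP/obs_mx_mul_eq0/(_ 0%N); rewrite expmx0 mulmx1 => Cx.
    by rewrite -row_mul Cx row0.
  move=> /eqP/obs_mx_mul_eq0 CAx; apply/eqP/obs_mx_mul0 => k.
  by have := CAx k.+1; rewrite expmxSr !mulmxA.
suff W0 : ker_space (obs_mx S) = 0%VS.
  rewrite /completely_observable -mxrank_tr; apply/eqP.
  rewrite -/(row_free _) -kermx_eq0; apply/eqP/row_matrixP => i.
  rewrite row0; apply: trmx_inj; rewrite trmx0; apply/eqP.
  rewrite -memv0 -W0 mem_ker_space -trmx_eq0 trmx_mul trmxK.
  by rewrite -row_mul mulmx_ker row0.
apply/eqP; have [//|WT] := boolP (_ == _).
have prW : proper_nonzero W.
  split=> [/(_ true) /= H|/(_ false) /= H]; first by rewrite H eqxx in WT.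
  have := dimvf ('cV[K]_1 : vectType K); rewrite -H dimv0 dim_cV.
  by [].
have := ss W subW prW; rewrite pairing_sys /= /theta_minus.
by rewrite dimv0 mulr0 addr0 mulN1r oppr_ge0 lez_nat leqn0 dimv_eq0 (negbTE WT).
Qed.

(** A subrepresentation that is zero on the left lies in the kernel of the
    observability matrix on the right; one that is everything on the left has
    weight [n - dim], positive if it is proper. *)
Lemma stable_co S : completely_observable S ->
  stable (@theta_minus m n p) (rep_of_sys S).
Proof.
move=> coS W subW [nzW npW]; rewrite pairing_sys /theta_minus mulN1r addrC subr_gt0.
have [W0|W1] := left_space_cases (W false); last first.
  have WT : W true != fullv.
    by apply/eqP => WT; apply: npW => -[].
  rewrite W1 dimvf dim_cV mulr1 ltz_nat.
  have := dimv_leqif_eq (subvf (W true)); rewrite dimvf dim_cV => /ltn_leqif ->.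
  exact: WT.
case: nzW => -[] //; apply/vspaceP => x; rewrite memv0.
apply/idP/eqP => [xW|->]; last exact: mem0v.
have WA k : sysA S ^+ k *m x \in W true.
  elim: k => [|k IH]; first by rewrite expmx0 mul1mx.
  by rewrite expmxS -mulmxA; apply: (subW (inr tt)).
have Sx : obs_mx S *m x = 0.
  apply: obs_mx_mul0 => k; apply/row_matrixP => i.
  rewrite row0 -mulmxA row_mul; apply/eqP.
  by have := subW (inl (inr i)) _ (WA k); rewrite W0 memv0.
have /row_fullP[Z ZS] : row_full (obs_mx S) by apply/eqP.
by rewrite -[x]mul1mx -ZS -mulmxA Sx mulmx0.
Qed.

Lemma stable_semistable theta (V : reps) : stable theta V -> semistable theta V.
Proof. by move=> st W subW prW; apply/ltW/st. Qed.

End Stability.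

Theorem mainTheorem5 (R : realType) (m n p : nat) :
  (fisomorphic (sys_cc R[i] m n p)
     (moduli R[i] (@sys_dim m n p) (@theta_plus m n p)) /\
   fisomorphic (sys_cc R[i] m n p)
     (moduli_stable R[i] (@sys_dim m n p) (@theta_plus m n p))) /\
  (fisomorphic (sys_co R[i] m n p)
     (moduli R[i] (@sys_dim m n p) (@theta_minus m n p)) /\
   fisomorphic (sys_co R[i] m n p)
     (moduli_stable R[i] (@sys_dim m n p) (@theta_minus m n p))).
Proof.
split; split.
- apply: (orbit_space_git_quotient (eps := 1)) => // [|S||].
  + by rewrite mulr1.
  + split=> [/stable_cc/stable_semistable//|]; exact: semistable_cc.
  + exact: cc_act.
  + exact: cc_chart.
- apply: (orbit_space_git_quotient (eps := 1)) => // [|S||].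
  + by rewrite mulr1.
  + split=> [/stable_cc//|/stable_semistable]; exact: semistable_cc.
  + exact: cc_act.
  + exact: cc_chart.
- apply: (orbit_space_git_quotient (eps := -1)) => // [|S||].
  + by rewrite mulrN1 opprK.
  + split=> [/stable_co/stable_semistable//|]; exact: semistable_co.
  + exact: co_act.
  + exact: co_chart.
- apply: (orbit_space_git_quotient (eps := -1)) => // [|S||].
  + by rewrite mulrN1 opprK.
  + split=> [/stable_co//|/stable_semistable]; exact: semistable_co.
  + exact: co_act.
  + exact: co_chart.
Qed.
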